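(* Let $M=G/L$ be a homogeneous manifold of a reductive Lie group $G=G^s\cdot Z(G)$ with a non-trivial connected center $Z(G)$ and a reductive stability subgroup $L$, and let $M^s=G^s/L_s$ be the associated homogeneous manifold of the semisimple Lie group $G^s$. Then any invariant Riemannian or Lorentzian metric on $M^s=G^s/L_s$ may be extended to an invariant Lorentzian metric on $M=G/L$.
   Context: $G$ is connected, $L\subset G$ is closed and connected, and $G$ acts almost effectively on $M=G/L$ (i.e. $L$ contains no non-discrete normal subgroup of $G$). $G^s$ is the semisimple part of $G$, and $\mathfrak{g}=\mathfrak{g}^s+Z(\mathfrak{g})$ is the corresponding decomposition of $\mathfrak{g}=\mathrm{Lie}(G)$ into the semisimple ideal $\mathfrak{g}^s$ and the (non-zero) center $Z(\mathfrak{g})$. By effectivity $\mathfrak{l}\cap Z(\mathfrak{g})=0$ for $\mathfrak{l}=\mathrm{Lie}(L)$, so the projection to $\mathfrak{g}^s$ maps $\mathfrak{l}$ isomorphically onto $\mathfrak{l}_s:=\mathrm{pr}_{\mathfrak{g}^s}(\mathfrak{l})\subset\mathfrak{g}^s$, and the adjoint actions of $\mathfrak{l}$ and $\mathfrak{l}_s$ on $\mathfrak{g}$ coincide. $L_s\subset G^s$ is the connected subgroup with Lie algebra $\mathfrak{l}_s$ (assumed closed, so that $M^s=G^s/L_s$ is a homogeneous manifold). Since $\mathfrak{l}_s$ is reductive there is a reductive (i.e. $\mathrm{ad}_{\mathfrak{l}_s}$-invariant) decomposition $\mathfrak{g}^s=\mathfrak{l}_s+\mathfrak{m}_s$, and this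 gives the reductive decomposition $\mathfrak{g}=\mathfrak{l}+\mathfrak{m}$ with $\mathfrak{m}=\mathfrak{m}_s+Z(\mathfrak{g})$. Invariant pseudo-Riemannian metrics on $M$ (resp. $M^s$) are identified with $\mathrm{ad}_{\mathfrak{l}}$-invariant (resp. $\mathrm{ad}_{\mathfrak{l}_s}$-invariant) pseudo-Euclidean inner products on $\mathfrak{m}$ (resp. $\mathfrak{m}_s$). An extension of an invariant metric on $M^s$, given by an inner product $g_{\mathfrak{m}_s}$ on $\mathfrak{m}_s$, is an invariant metric on $M$ whose inner product on $\mathfrak{m}=\mathfrak{m}_s+Z(\mathfrak{g})$ restricts to $g_{\mathfrak{m}_s}$ on $\mathfrak{m}_s$. *)

(* Defs.v *)
From HB Require Import structures.
From mathcomp Require Import all_boot all_order all_algebra.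
From mathcomp Require Import all_classical all_reals all_analysis.

Set Implicit Arguments.
Unset Strict Implicit.
Unset Printing Implicit Defensive.

Import Order.TTheory GRing.Theory Num.Theory.
Import numFieldNormedType.Exports.

Local Open Scope classical_set_scope.
Local Open Scope ring_scope.

HB.mixin Record Group_isTopologicalGroup G of Group G & Topological G := {
  mulg_continuous : continuous (fun xy : G * G => (xy.1 * xy.2)%g) ;
  invg_continuous : continuous (fun x : G => (x^-1)%g)
}.

#[short(type="topologicalGroupType")]
HB.structure Definition TopologicalGroup :=
  {G of Group G & Topological G & Group_isTopologicalGroup G}.

Section Subgroups.
Variable G : topologicalGroupType.
Implicit Types H N : set G.

Definition subgroup H :=
  [/\ H 1%g, forall x y, H x -> H y -> H (x * y)%g & forall x, H x -> H (x^-1)%g].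

Definition normal_subgroup N :=
  subgroup N /\ forall x y, N y -> N (x * y * x^-1)%g.

Definition group_center : set G := [set z | forall x : G, (z * x = x * z)%g].

Definition discrete_subset N := forall x, N x -> \forall y \near x, N y -> y = x.

Definition almost_effective H :=
  forall N, normal_subgroup N -> N `<=` H -> discrete_subset N.

End Subgroups.

Arguments group_center : clear implicits.

Section LieAlgebras.
Variables (R : realType) (n : nat).
Local Notation V := 'rV[R]_n.

(* Every real Lie algebra of dimension n is, in a basis, a bracket on R^n. *)
Definition lie_bracket_axioms (br : V -> V -> V) :=
  [/\ forall (a : R) X Y Z, br (a *: X + Y) Z = a *: br X Z + br Y Z,
      forall (a : R) X Y Z, br Z (a *: X + Y) = a *: br Z X + br Z Y,
      forall X, br X X = 0
    & forall X Y Z, br X (br Y Z) + br Y (br Z X) + br Z (br X Y) = 0].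

Variable br : V -> V -> V.
Implicit Types h k i s z m : {vspace V}.

Definition lie_ideal h i :=
  (i <= h)%VS /\ forall X Y, X \in h -> Y \in i -> br X Y \in i.

Definition lie_product h k : {vspace V} :=
  <<[seq br X Y | X <- vbasis h, Y <- vbasis k]>>%VS.

Definition lie_solvable h :=
  exists d, iter d (fun k => lie_product k k) h = 0%VS.

Definition lie_semisimple h := forall i, lie_ideal h i -> lie_solvable i -> i = 0%VS.

Definition is_lie_center h z :=
  forall X, X \in z <-> (X \in h /\ forall Y, Y \in h -> br X Y = 0).

Definition reductive_splitting h s z :=
  [/\ lie_ideal h s, lie_semisimple s, is_lie_center h z,
      (s + z)%VS = h & (s :&: z)%VS = 0%VS].

Definition lie_reductive h := exists s z, reductive_splitting h s z.

Definition reductive_complement h k m :=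
  [/\ (k + m)%VS = h, (k :&: m)%VS = 0%VS
    & forall X Y, X \in k -> Y \in m -> br X Y \in m].

(* Forms are functions on all of V; only their values on m x m are meaningful. *)
Definition inner_product_on m (B : V -> V -> R) :=
  [/\ forall a X Y Z, X \in m -> Y \in m -> Z \in m ->
        B (a *: X + Y) Z = a * B X Z + B Y Z,
      forall X Y, X \in m -> Y \in m -> B X Y = B Y X
    & forall X, X \in m -> (forall Y, Y \in m -> B X Y = 0) -> X = 0].

Definition riemannian_on m (B : V -> V -> R) :=
  forall X, X \in m -> X != 0 -> 0 < B X X.

Definition has_signature m (B : V -> V -> R) (p q : nat) :=
  exists e : (p + q).-tuple V, basis_of m e /\
    forall i j : 'I_(p + q), B (tnth e i) (tnth e j) =
      if i == j then (if (i < p)%N then 1 else -1) else 0.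

Definition lorentzian_on m (B : V -> V -> R) := exists p, has_signature m B p 1.

(* Inner product on m of an invariant pseudo-Riemannian metric on H/K, where
   K is connected, Lie H = h, Lie K = k and m is a reductive complement. *)
Definition invariant_metric h k m (B : V -> V -> R) :=
  [/\ reductive_complement h k m, inner_product_on m B
    & forall X Y Z, X \in k -> Y \in m -> Z \in m ->
        B (br X Y) Z + B Y (br X Z) = 0].

End LieAlgebras.

(* A Lie group of dimension n, presented by its exponential map in a basis of
   its Lie algebra. By exp_nbhs_inj and exp_nbhs_open, exp is a chart at 1, so
   that G is a locally Euclidean topological group and carries exactly one
   compatible smooth structure (Gleason, Montgomery and Zippin). The curves
   t |-> exp (t X) are then precisely the one-parameter subgroups of G; the
   addition of the Lie algebra is forced by exp_trotter, Ad by exp_Ad, and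
   the bracket by ad = d(Ad). Conversely every Lie group has all these
   properties. *)
Record lie_group_structure (R : realType) (G : topologicalGroupType) (n : nat) :=
  LieGroupStructure {
    lie_br : 'rV[R]_n -> 'rV[R]_n -> 'rV[R]_n ;
    lie_exp : 'rV[R]_n -> G ;
    lie_Ad : G -> 'End('rV[R]_n) ;
    lie_hausdorff : hausdorff_space G ;
    lie_brP : lie_bracket_axioms lie_br ;
    lie_expD : forall (s t : R) X,
      lie_exp ((s + t) *: X) = (lie_exp (s *: X) * lie_exp (t *: X))%g ;
    exp_continuous : continuous lie_exp ;
    exp_nbhs_inj : exists2 U, nbhs (0 : 'rV[R]_n) U & {in U &, injective lie_exp} ;
    exp_nbhs_open : forall U, nbhs (0 : 'rV[R]_n) U -> nbhs (1%g : G) (lie_exp @` U) ;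
    exp_trotter : forall X Y,
      (fun k : nat => (lie_exp (k.+1%:R^-1 *: X) * lie_exp (k.+1%:R^-1 *: Y)) ^+ k.+1)%g
        @ \oo --> lie_exp (X + Y) ;
    exp_Ad : forall x X, (x * lie_exp X * x^-1)%g = lie_exp (lie_Ad x X) ;
    derive_Ad : forall X Y,
      is_derive (0 : R) 1 (fun t : R => lie_Ad (lie_exp (t *: X)) Y) (lie_br X Y)
  }.

Section LieSubgroups.
Variables (R : realType) (G : topologicalGroupType) (n : nat).
Variable S : lie_group_structure R G n.
Implicit Types h k : {vspace 'rV[R]_n}.

Definition is_lie_algebra_of (L : set G) h :=
  forall X, X \in h <-> (forall t : R, L (lie_exp S (t *: X))).

(* The connected subgroup with Lie algebra h. *)
Definition analytic_subgroup h : set G :=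
  smallest (@subgroup G) (lie_exp S @` [set X | X \in h]).

(* Closedness in the Lie group topology of the connected subgroup with Lie
   algebra h, which may be finer than the one induced by G: the sets
   x exp (U `&` h), with U a neighbourhood of 0, are a base at x. *)
Definition closed_in_analytic h (A : set G) :=
  A `<=` analytic_subgroup h /\
  forall x, analytic_subgroup h x ->
    (forall U, nbhs (0 : 'rV[R]_n) U ->
      exists X, [/\ X \in h, U X & A (x * lie_exp S X)%g]) -> A x.

End LieSubgroups.

(* Main.v *)
Require Import Defs.
From HB Require Import structures.
From mathcomp Require Import all_boot all_order all_algebra.
From mathcomp Require Import all_classical all_reals all_analysis.
Set Implicit Arguments.
Unset Strict Implicit.
Unset Printing Implicit Defensive.
Import Order.TTheory GRing.Theory Num.Theory.
Import numFieldNormedType.Exports.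
Local Open Scope classical_set_scope.
Local Open Scope ring_scope.

(** Write [m = ms + zg], where [zg] is the center of the Lie algebra. On [m] the
    metric is the orthogonal sum of [gms] on [ms] and an arbitrary inner product
    [h] on [zg]. Since [l] acts on [m] through its projection [ls] to [gs], and
    trivially on [zg], this sum is [l]-invariant for every choice of [h]. If
    [gms] is Riemannian, [h] is chosen Lorentzian; if [gms] is Lorentzian, [h]
    is chosen positive definite. In both cases the sum has exactly one negative
    direction ([lorentzian_orthogonal_extension]).

    The group enters twice.

    First, [zg] must be non-zero, for otherwise no negative direction is
    available in the Riemannian case ([lie_center_neq0]). Near [1] a central
    element is [exp X] with [X] small, and then [Ad y X = X] for [y] near [1] by
    local injectivity of [exp], so that [X] is central in the Lie algebra. If
    [zg = 0], the center of the group would thus be discrete, hence trivial,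
    being connected.

    Second, [l] meets [zg] trivially, so that [ms + zg] is a complement of [l]
    ([effective_center_trivial]). Indeed [X] in [zg] is fixed by each
    [Ad (exp Y)], because [t |-> Ad (exp (t Y)) X] has derivative zero, so that
    [exp X] commutes with the connected subgroup of [gs]; as the group is the
    product of this subgroup and its center, [exp X] is central. Therefore [exp]
    maps the intersection of [l] and [zg] onto a normal subgroup contained in
    [L], which is discrete by almost effectivity; this forces the intersection
    to vanish. *)

(** * Preliminaries on Lie brackets, connectedness and linear functionals *)

Lemma lie_bracketC (R : realType) (n : nat) (br : 'rV[R]_n -> 'rV[R]_n -> 'rV[R]_n) X Y :
  lie_bracket_axioms br -> br X Y = - br Y X.
Proof.
move=> [brl brr brxx _]; have := brxx (1 *: X + Y).
by rewrite brl !brr !brxx !scale1r addr0 add0r => /eqP; rewrite addr_eq0 => /eqP.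
Qed.

Lemma rV_functional_continuous (R : realType) (n : nat)
  (phi : {linear 'rV[R]_n -> R}) : continuous phi.
Proof.
have -> : (phi : 'rV[R]_n -> R) = fun v => \sum_i v 0 i * phi (delta_mx 0 i).
  apply/funext => v; rewrite {1}[v]row_sum_delta linear_sum.
  by apply: eq_bigr => i _; rewrite linearZ.
apply: continuous_big => [|i _ v]; first exact: add_continuous.
exact: (cvgMr_tmp (@coord_continuous R 1 n 0 i v)).
Qed.

Lemma connected_isolated_point (T : topologicalType) (A : set T) (x : T) :
  hausdorff_space T -> connected A -> A x ->
  (\forall y \near x, A y -> y = x) -> A = [set x].
Proof.
move=> hT Ac Ax nearx; apply/esym; apply: Ac; first by exists x.
- exists (interior [set y | A y -> y = x]); first exact: open_interior.
  apply/seteqP; split => [_ ->|y [Ay /interior_subset/(_ Ay)]] //.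
- exists [set x]; last by apply/seteqP; split => [_ ->|y []].
  exact: accessible_closed_set1 (hausdorff_accessible hT) x.
Qed.

(** * The center of a Lie group and of its Lie algebra *)

Section LieGroups.
Variables (R : realType) (G : topologicalGroupType) (n : nat).
Variable S : lie_group_structure R G n.
Local Notation V := 'rV[R]_n.
Local Notation br := (lie_br S).
Local Notation exp := (lie_exp S).
Local Notation Ad := (lie_Ad S).
Implicit Types (X Y Z : V) (x y z : G).

Lemma scalel_cvg0 X : (fun t : R => t *: X) @ 0 --> (0 : V).
Proof. by rewrite -[X in _ --> X](scale0r X); apply: cvgZr_tmp; exact: cvg_id. Qed.

Lemma exp0 : exp 0 = 1%g.
Proof.
have h := lie_expD S 0 0 0; rewrite !scaler0 in h.
by apply: (mulgI (exp 0)); rewrite -h mulg1.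
Qed.

Lemma expN X : exp (- X) = (exp X)^-1%g.
Proof.
have h := lie_expD S (-1) 1 X; rewrite addNr scale0r exp0 scale1r scaleN1r in h.
by apply: (mulIg (exp X)); rewrite -h mulVg.
Qed.

(** Local injectivity of [exp] near [0] separates one-parameter subgroups. It
    yields below that [Ad] is a homomorphism. *)
Lemma exp_line_inj X Y : (forall t : R, exp (t *: X) = exp (t *: Y)) -> X = Y.
Proof.
move=> eXY; have [U U0 Uinj] := exp_nbhs_inj S.
have H : \forall t \near (0 : R)^', [/\ U (t *: X), U (t *: Y) & t != 0].
  near=> t; split; last by near: t; exact: nbhs_dnbhs_neq.
  - near: t; apply: (@nbhs_dnbhs _ (0:R)); exact: scalel_cvg0 U0.
  - near: t; apply: (@nbhs_dnbhs _ (0:R)); exact: scalel_cvg0 U0.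
have [t [UX UY t0]] := filter_ex H.
apply: (scalerI t0); apply: Uinj; rewrite ?inE //; exact: eXY.
Unshelve. all: by end_near.
Qed.

Lemma Ad1 X : Ad 1%g X = X.
Proof. by apply: exp_line_inj => t; rewrite -linearZ -exp_Ad mul1g invg1 mulg1. Qed.

Lemma AdM x y X : Ad (x * y)%g X = Ad x (Ad y X).
Proof.
apply: exp_line_inj => t; rewrite -!linearZ -!exp_Ad invgM.
by rewrite !mulgA.
Qed.

(** The curve [t |-> Ad (exp (t Y)) X] has derivative [Ad (exp (t Y)) (br Y X)],
    which vanishes; hence it is constant. *)
Lemma Ad_exp_central X Y : br Y X = 0 -> Ad (exp Y) X = X.
Proof.
move=> YX0; pose f (t : R) := Ad (exp (t *: Y)) X.
suff f_cst : f 1 = f 0 by move: f_cst; rewrite /f scale1r scale0r exp0 Ad1.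
apply/rowP => j.
apply: (@is_derive_0_is_cst R (fun t => f t 0 j)) => t.
(* The linear map [Ad (exp (t Y))] carries the difference quotient at [0] to the
   difference quotient at [t]. *)
pose phi := (fun v : V => Ad (exp (t *: Y)) v 0 j).
have phi_lin : linear phi by move=> a u v; rewrite /phi linearP !mxE.
pose phiL : {linear V -> R} := HB.pack phi (GRing.isLinear.Build _ _ _ _ _ phi_lin).
have [fdrv fval] := derive_Ad S Y X.
have q_cvg : (fun h : R => h^-1 *: ((f \o shift 0) (h *: 1) - f 0)) @ 0^' --> (0 : V).
  by rewrite -YX0 -fval; exact: fdrv.
have qE : (fun h : R => h^-1 *: (((fun t => f t 0 j) \o shift t) (h *: 1) - f t 0 j))
  = phiL \o (fun h : R => h^-1 *: ((f \o shift 0) (h *: 1) - f 0)).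
  apply/funext => h.
  rewrite [RHS](_ : _ = phiL (h^-1 *: (f (h *: 1 + 0) - f 0))) // [RHS]linearZ.
  congr (_ *: _).
  by rewrite /= /phi /f linearB !mxE /= -!AdM -!lie_expD !addr0 [t + _]addrC.
have dq_cvg : (fun h : R => h^-1 *:
    (((fun t => f t 0 j) \o shift t) (h *: 1) - f t 0 j)) @ 0^' --> (0 : R).
  have phi_cvg : phiL @ (0 : V) --> phiL 0 by exact: rV_functional_continuous.
  by rewrite qE; move: phi_cvg; rewrite (linear0 phiL); exact: cvg_comp q_cvg.
split; first exact: cvgP dq_cvg.
exact: cvg_lim dq_cvg.
Qed.

Lemma continuous_Ad_exp X Y : (fun t : R => Ad (exp (t *: Y)) X) @ 0 --> X.
Proof.
have [fdrv _] := derive_Ad S Y X.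
pose f (t : R) := Ad (exp (t *: Y)) X.
have f_cvg : f @ (0 : R) --> f 0 by exact/differentiable_continuous/derivable1_diffP.
by move: f_cvg; rewrite {2}/f scale0r exp0 Ad1.
Qed.

(** Near [1], the center of the group is the exponential of the center of the
    Lie algebra. *)
Lemma central_exp_near0 : \forall X \near (0 : V),
  group_center G (exp X) -> forall Y, br Y X = 0.
Proof.
have [U U0 Uinj] := exp_nbhs_inj S.
near=> X => cX Y.
have UX : nbhs X U by near: X; exact/nbhs_interior.
(* [exp (Ad (exp (t Y)) X) = exp X], and both arguments of [exp] lie in [U]. *)
have eqX : \forall t \near (0 : R), Ad (exp (t *: Y)) X = X.
  near=> t; apply: Uinj; rewrite ?inE.
  - near: t; exact: continuous_Ad_exp UX.
  - exact: nbhs_singleton UX.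
  - by rewrite -exp_Ad -cX mulgK.
have [fdrv <-] := derive_Ad S Y X.
apply: cvg_lim => //; apply: cvg_near_cst.
near=> h; rewrite /= !addr0 scale0r exp0 Ad1 scaler1 [Ad _ X](_ : _ = X).
  by rewrite subrr scaler0.
near: h; exact: nbhs_dnbhs.
Unshelve. all: by end_near.
Qed.

Lemma centralizer_subgroup z : subgroup [set y | (y * z = z * y)%g].
Proof.
split=> /= [|x y xz yz|x xz]; first by rewrite mul1g mulg1.
- by rewrite -mulgA yz !mulgA xz.
- by apply: (mulgI x); rewrite mulVKg mulgA xz mulgK.
Qed.

Lemma lie_center_exp_central gs (zg : {vspace V})
  (zgP : is_lie_center br fullv zg)
  (G_product : forall x : G, exists a z : G,
     [/\ analytic_subgroup S gs a, group_center G z & x = (a * z)%g]) X :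
  X \in zg -> group_center G (exp X).
Proof.
move=> /zgP [_ Xc] x; have [a [z [aG zc ->]]] := G_product x.
have /= aX : [set y | (y * exp X = exp X * y)%g] a.
  apply: aG; split; first exact: centralizer_subgroup.
  move=> _ [Y _ <-] /=; apply: (mulIg (exp Y)^-1%g).
  by rewrite mulgK exp_Ad Ad_exp_central // (lie_bracketC _ _ (lie_brP S)) Xc ?oppr0 ?memvf.
by rewrite -mulgA zc mulgA -aX mulgA.
Qed.

(** When [exp (t X)] is central for all [t], the sequence of the Trotter formula is
    constant. *)
Lemma exp_add_central X Y : (forall t : R, group_center G (exp (t *: X))) ->
  exp (X + Y) = (exp X * exp Y)%g.
Proof.
move=> Xc.
have expMn k Z : exp (k%:R *: Z) = (exp Z ^+ k)%g.
  elim: k => [|k IH]; first by rewrite scale0r exp0.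
  by rewrite -natr1 lie_expD scale1r IH expgSr.
have cst : (fun k : nat => (exp (k.+1%:R^-1 *: X) * exp (k.+1%:R^-1 *: Y)) ^+ k.+1)%g
   = (fun=> exp X * exp Y)%g.
  apply/funext => k; rewrite expgMn; last exact: Xc.
  by rewrite -!expMn !scalerA divff ?pnatr_eq0// !scale1r.
have := @exp_trotter _ _ _ S X Y; rewrite cst => h.
apply: (@cvg_unique _ (lie_hausdorff S) _ _ _ _ h); exact: cvg_cst.
Qed.

Lemma exp_central_subspace_normal (k : {vspace V})
  (kc : forall X, X \in k -> group_center G (exp X)) :
  normal_subgroup (exp @` [set X | X \in k]).
Proof.
have kZ X : X \in k -> forall t : R, group_center G (exp (t *: X)).
  by move=> Xk t; apply: kc; exact: memvZ.
split; first split.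
- by exists 0; [exact: mem0v | exact: exp0].
- move=> _ _ [X /= Xk <-] [Y /= Yk <-]; exists (X + Y); first exact: memvD.
  exact/exp_add_central/kZ.
- by move=> _ [X /= Xk <-]; exists (- X); [rewrite /= memvN | exact: expN].
- move=> x _ [X /= Xk <-]; exists X => //.
  by rewrite -(kc _ Xk x) mulgK.
Qed.

Lemma exp_subspace_discrete (k : {vspace V}) :
  discrete_subset (exp @` [set X | X \in k]) -> k = 0%VS.
Proof.
move=> kd; apply/eqP; rewrite -subv0; apply/subvP => X Xk; rewrite memv0; apply/eqP.
have [U U0 Uinj] := exp_nbhs_inj S.
have d1 : \forall y \near (1%g : G), (exp @` [set X | X \in k]) y -> y = 1%g.
  by apply: kd; exists 0; [exact: mem0v | exact: exp0].
have exp_cvg : exp @ (0 : V) --> (1%g : G) by rewrite -exp0; exact: exp_continuous.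
have exp1 : \forall Y \near (0 : V), (exp @` [set X | X \in k]) (exp Y) -> exp Y = 1%g.
  exact: exp_cvg d1.
have near0 : \forall Y \near (0 : V), Y \in k -> Y = 0.
  near=> Y => Yk; apply: Uinj; rewrite ?inE.
  - by near: Y.
  - exact: nbhs_singleton U0.
  - rewrite exp0; have : (exp @` [set X | X \in k]) (exp Y) by exists Y.
    by near: Y.
have H : \forall t \near (0 : R)^', t *: X = 0 /\ t != 0.
  near=> t; split; last by near: t; exact: nbhs_dnbhs_neq.
  have : t *: X \in k by exact: memvZ.
  near: t; apply: (@nbhs_dnbhs _ (0:R)); exact: scalel_cvg0 near0.
have [t [tX t0]] := filter_ex H.
by move/eqP: tX; rewrite scaler_eq0 (negbTE t0) => /eqP.
Unshelve. all: by end_near.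
Qed.

Lemma effective_center_trivial (L : set G) (l zg gs : {vspace V})
  (zgP : is_lie_center br fullv zg)
  (G_product : forall x : G, exists a z : G,
     [/\ analytic_subgroup S gs a, group_center G z & x = (a * z)%g])
  (L_algebra : is_lie_algebra_of S L l) (L_effective : almost_effective L) :
  (l :&: zg = 0)%VS.
Proof.
apply: exp_subspace_discrete; apply: L_effective.
  apply: exp_central_subspace_normal => X /memv_capP[_ Xz].
  exact: lie_center_exp_central zgP G_product _ Xz.
move=> _ [X /= /memv_capP[Xl _] <-].
by have /L_algebra/(_ 1) := Xl; rewrite scale1r.
Qed.

Lemma lie_center_neq0 (zg : {vspace V})
  (zgP : is_lie_center br fullv zg)
  (ZG_connected : connected (group_center G))
  (ZG_nontrivial : group_center G <> [set 1%g]) : zg != 0%VS.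
Proof.
apply/eqP => zg0; apply: ZG_nontrivial; apply: connected_isolated_point => //.
- exact: lie_hausdorff S.
- by move=> x; rewrite mul1g mulg1.
have W := @exp_nbhs_open _ _ _ S _ central_exp_near0.
near=> y => yc.
have [X Xc eX] : (exp @` [set X | group_center G (exp X) -> forall Y, br Y X = 0]) y.
  by near: y; exact: W.
suff /eqP X0 : X == 0 by rewrite -eX X0 exp0.
rewrite -memv0 -zg0; apply/zgP; split=> [|Y _]; first exact: memvf.
by rewrite (lie_bracketC _ _ (lie_brP S)) Xc ?oppr0 // eX.
Unshelve. all: by end_near.
Qed.

End LieGroups.

(** * Inner products on subspaces and their signatures *)

Section InnerProducts.
Variables (R : realType) (n : nat).
Local Notation V := 'rV[R]_n.
Implicit Types (X Y Z : V) (m : {vspace V}) (B : V -> V -> R).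

Lemma inner_product0l m B Z : inner_product_on m B -> Z \in m -> B 0 Z = 0.
Proof.
move=> [Bl _ _] Zm; have := Bl 1 0 0 Z (mem0v _) (mem0v _) Zm.
by rewrite scale1r addr0 mul1r => B0; apply: (addrI (B 0 Z)); rewrite addr0.
Qed.

Lemma inner_productZl m B a X Z : inner_product_on m B -> X \in m -> Z \in m ->
  B (a *: X) Z = a * B X Z.
Proof.
move=> mB Xm Zm; have [Bl _ _] := mB.
by rewrite -[a *: X]addr0 Bl ?mem0v // (inner_product0l mB) ?addr0.
Qed.

Lemma inner_product_suml m B k (c : 'I_k -> R) (F : 'I_k -> V) Z :
  inner_product_on m B -> (forall i, F i \in m) -> Z \in m ->
  B (\sum_i c i *: F i) Z = \sum_i c i * B (F i) Z.
Proof.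
move=> mB Fm Zm; have [Bl _ _] := mB.
pose P (X : V) (a : R) := X \in m /\ B X Z = a.
suff [] : P (\sum_i c i *: F i) (\sum_i c i * B (F i) Z) by [].
apply: (big_rec2 P); first by split; [exact: mem0v | exact: inner_product0l mB Zm].
move=> i a X _ [Xm <-]; split; last exact: Bl.
by rewrite memvD ?memvZ.
Qed.

(** Signature in terms of a sequence, which can be concatenated without casts. *)
Lemma has_signatureP m B p q : has_signature m B p q <->
  exists e : seq V, [/\ size e = (p + q)%N, basis_of m e &
    forall i j, (i < p + q)%N -> (j < p + q)%N ->
      B e`_i e`_j = if i == j then (if (i < p)%N then 1 else -1) else 0].
Proof.
split=> [[e [em eB]]|[e [se em eB]]].
  exists e; split; [exact: size_tuple | by [] |] => i j ip jp.
  by have := eB (Ordinal ip) (Ordinal jp); rewrite !(tnth_nth 0).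
have /eqP se' := se; exists (Tuple se'); split=> // i j.
by rewrite !(tnth_nth 0) /= eB.
Qed.

Lemma eq_has_signature m B B' p q : {in m &, B =2 B'} ->
  has_signature m B p q -> has_signature m B' p q.
Proof.
move=> BB' [e [em eB]]; exists e; split=> // i j.
by rewrite -eB BB' // (basis_mem em) // mem_tnth.
Qed.

Lemma has_signature_addv m1 m2 B p1 p2 q : (m1 :&: m2 = 0)%VS ->
  {in m1 & m2, forall X Y, B X Y = 0} -> {in m1 & m2, forall X Y, B Y X = 0} ->
  has_signature m1 B p1 0 -> has_signature m2 B p2 q ->
  has_signature (m1 + m2)%VS B (p1 + p2) q.
Proof.
move=> m120 B12 B21 /has_signatureP[e1 [s1 b1 h1]] /has_signatureP[e2 [s2 b2 h2]].
rewrite addn0 in s1 h1.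
apply/has_signatureP; exists (e1 ++ e2); split.
- by rewrite size_cat s1 s2 addnA.
- by apply: cat_basis => //; apply/directv_addP.
have m1_nth i : (i < p1)%N -> e1`_i \in m1.
  by move=> ip; rewrite (basis_mem b1) // mem_nth // s1.
have m2_nth i : (i - p1 < p2 + q)%N -> e2`_(i - p1) \in m2.
  by move=> ip; rewrite (basis_mem b2) // mem_nth // s2.
have shift i : (p1 <= i)%N -> (i < p1 + p2 + q)%N -> (i - p1 < p2 + q)%N.
  by move=> pi; rewrite ltn_subLR // addnA.
move=> i j ip jp; rewrite !nth_cat s1.
case: (ltnP i p1) => i1; case: (ltnP j p1) => j1.
- by rewrite h1 // i1 (leq_trans i1) ?leq_addr.
- by rewrite B12 ?m1_nth ?m2_nth ?shift // ltn_eqF // (leq_trans i1).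
- by rewrite B21 ?m1_nth ?m2_nth ?shift // gtn_eqF // (leq_trans j1).
- by rewrite h2 ?shift // eqn_sub2rE // ltn_subLR.
Qed.

(** Gram-Schmidt orthonormalization, one vector at a time. *)
Lemma riemannian_orthonormal_free m B k :
  inner_product_on m B -> riemannian_on m B -> (k <= \dim m)%N ->
  exists e : seq V, [/\ size e = k, {subset e <= m}, free e &
    forall i j, (i < k)%N -> (j < k)%N -> B e`_i e`_j = (i == j)%:R].
Proof.
move=> mB Bpos; have [Bl Bsym _] := mB.
elim: k => [|k IHk] km; first by exists [::]; rewrite nil_free.
have [e [se em fe eB]] := IHk (ltnW km).
have /subvPn[v vm ve] : ~~ (m <= <<e>>)%VS.
  by apply: contraL km => /dimvS; rewrite -leqNgt (eqnP fe) se.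
have nth_m (i : 'I_k) : e`_i \in m by rewrite em // mem_nth // se.
pose s := \sum_(i < k) - B v e`_i *: e`_i.
(* The factor [1] gives [w] the shape [a *: X + Y] of the linearity axiom. *)
pose w := 1 *: v + s.
have se_mem : s \in <<e>>%VS.
  by apply: memv_suml => i _; rewrite memvZ // memv_span // mem_nth // se.
have sm : s \in m by apply: memv_suml => i _; rewrite memvZ.
have we : w \notin <<e>>%VS by rewrite /w scale1r rpredDr.
have wm : w \in m by rewrite memvD // memvZ.
have wpos : 0 < B w w.
  by apply: Bpos => //; apply: contraNneq we => ->; exact: mem0v.
have w_orth (j : 'I_k) : B w e`_j = 0.
  rewrite Bl // mul1r (inner_product_suml _ mB) // (bigD1 j) //= eB // eqxx.
  rewrite mulr1 big1 ?addr0 ?subrr // => i ij.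
  by rewrite eB // (inj_eq val_inj) (negbTE ij) mulr0.
pose c := (Num.sqrt (B w w))^-1; pose u := c *: w.
have c0 : c != 0 by rewrite invr_eq0 sqrtr_eq0 -ltNge.
have um : u \in m by exact: memvZ.
have u_orth (j : 'I_k) : B u e`_j = 0.
  by rewrite (inner_productZl _ mB) // w_orth mulr0.
have uu : B u u = 1.
  rewrite (inner_productZl _ mB) // Bsym // (inner_productZl _ mB) // mulrA.
  by rewrite -expr2 exprVn sqr_sqrtr ?mulVf ?gt_eqF // ltW.
exists (u :: e); split.
- by rewrite /= se.
- by move=> x; rewrite inE => /orP[/eqP->//|]; exact: em.
- rewrite free_cons fe andbT; apply: contra we => ue.
  by rewrite -(scalerK c0 w) memvZ.
- move=> [|i] [|j] //= ik jk; rewrite ?eqxx ?eqSS ?eB //.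
  + have jk' : (j < k)%N by [].
    by rewrite (u_orth (Ordinal jk')).
  + have ik' : (i < k)%N by [].
    by rewrite Bsym ?(nth_m (Ordinal ik')) // (u_orth (Ordinal ik')).
Qed.

Lemma riemannian_has_signature m B :
  inner_product_on m B -> riemannian_on m B -> has_signature m B (\dim m) 0.
Proof.
move=> mB Bpos.
have [e [se em fe eB]] := riemannian_orthonormal_free mB Bpos (leqnn _).
apply/has_signatureP; exists e; split; first by rewrite addn0.
  by rewrite basisEfree fe se leqnn andbT; apply/span_subvP.
by move=> i j; rewrite addn0 => im jm; rewrite eB // im; case: eqP.
Qed.

Lemma inner_product_exists m p q : \dim m = (p + q)%N ->
  exists2 B, inner_product_on m B & has_signature m B p q.
Proof.
move=> dm; pose b := vbasis m; pose eps (i : nat) : R := if (i < p)%N then 1 else -1.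
pose B X Y := \sum_(i < \dim m) eps i * coord b i X * coord b i Y.
have fb : free b by exact: basis_free (vbasisP m).
have bmem (i : 'I_(\dim m)) : b`_i \in m by rewrite vbasis_mem // mem_nth // size_tuple.
have Bb X (j : 'I_(\dim m)) : B X b`_j = eps j * coord b j X.
  rewrite /B (bigD1 j) //= coord_free // eqxx mulr1 big1 ?addr0 // => i ij.
  by rewrite coord_free // eq_sym (negbTE ij) mulr0.
exists B.
  split.
  - move=> a X Y Z _ _ _; rewrite /B mulr_sumr -big_split; apply: eq_bigr => i _ /=.
    by rewrite linearP /= mulrDr mulrDl; congr (_ + _); rewrite !mulrA [a * _]mulrC.
  - by move=> X Y _ _; apply: eq_bigr => i _; rewrite mulrAC.
  - move=> X Xm X0; rewrite (coord_vbasis Xm) big1 // => i _.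
    have /eqP := X0 _ (bmem i); rewrite Bb mulf_eq0 => /orP[|/eqP ->]; last by rewrite scale0r.
    by rewrite /eps; case: ifP => _; rewrite ?oppr_eq0 oner_eq0.
apply/has_signatureP; exists b; split; [by rewrite size_tuple | exact: vbasisP|].
rewrite -dm => i j im jm.
rewrite (Bb _ (Ordinal jm)) (coord_free (Ordinal im) (Ordinal jm)) //.
rewrite -(inj_eq val_inj) /=.
by case: eqP => [->|_]; rewrite ?mulr1 ?mulr0.
Qed.

Lemma daddv_pi0 m1 m2 X : (m1 :&: m2 = 0)%VS -> X \in m2 -> daddv_pi m1 m2 X = 0.
Proof.
move=> m12 Xm; have := daddv_pi_add m12 (subvP (addvSr m1 m2) _ Xm).
by rewrite (@daddv_pi_id _ _ m2) 1?capvC // => h; apply: (addIr X); rewrite add0r.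
Qed.

(** The orthogonal direct sum of [B1] on [m1] and [B2] on [m2], as a form on
    [m1 + m2]; it is meant for [m1] and [m2] with trivial intersection, and
    evaluates the components given by the two projections of the direct sum. *)
Definition orthogonal_sum_form m1 m2 B1 B2 X Y : R :=
  B1 (daddv_pi m1 m2 X) (daddv_pi m1 m2 Y) + B2 (daddv_pi m2 m1 X) (daddv_pi m2 m1 Y).

Section OrthogonalSum.
Variables (m1 m2 : {vspace V}) (B1 B2 : V -> V -> R).
Hypothesis m12 : (m1 :&: m2 = 0)%VS.
Hypotheses (B1P : inner_product_on m1 B1) (B2P : inner_product_on m2 B2).
Local Notation B := (orthogonal_sum_form m1 m2 B1 B2).

Let m21 : (m2 :&: m1 = 0)%VS. Proof. by rewrite capvC. Qed.

Lemma orthogonal_sum_formE X1 X2 Y1 Y2 :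
  X1 \in m1 -> Y1 \in m1 -> X2 \in m2 -> Y2 \in m2 ->
  B (X1 + X2) (Y1 + Y2) = B1 X1 Y1 + B2 X2 Y2.
Proof.
move=> X1m Y1m X2m Y2m; rewrite /orthogonal_sum_form !linearD /=.
rewrite (daddv_pi0 m12 X2m) (daddv_pi0 m12 Y2m) (daddv_pi0 m21 X1m) (daddv_pi0 m21 Y1m).
by rewrite !daddv_pi_id // !addr0 !add0r.
Qed.

Lemma orthogonal_sum_form_l : {in m1 &, B =2 B1}.
Proof.
move=> X Y Xm Ym; rewrite -[X]addr0 -[Y in LHS]addr0 orthogonal_sum_formE ?mem0v //.
by rewrite addr0 (inner_product0l B2P) ?mem0v // addr0.
Qed.

Lemma orthogonal_sum_form_r : {in m2 &, B =2 B2}.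
Proof.
move=> X Y Xm Ym; rewrite -[X]add0r -[Y in LHS]add0r orthogonal_sum_formE ?mem0v //.
by rewrite add0r (inner_product0l B1P) ?mem0v // add0r.
Qed.

Lemma orthogonal_sum_form_orth : {in m1 & m2, forall X Y, B X Y = 0 /\ B Y X = 0}.
Proof.
move=> X Y Xm Ym; have [_ B1sym _] := B1P; have [_ B2sym _] := B2P.
split; rewrite -[X]addr0 -[Y]add0r orthogonal_sum_formE ?mem0v //.
  by rewrite (inner_product0l B2P) // B1sym ?mem0v // (inner_product0l B1P) // addr0.
by rewrite (inner_product0l B1P) // B2sym ?mem0v // (inner_product0l B2P) // addr0.
Qed.

Lemma inner_product_orthogonal_sum : inner_product_on (m1 + m2)%VS B.
Proof.
have [B1l B1sym B1nd] := B1P; have [B2l B2sym B2nd] := B2P.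
split.
- move=> a X Y Z _ _ _; rewrite /orthogonal_sum_form !linearP /=.
  by rewrite B1l ?memv_pi // B2l ?memv_pi // mulrDr addrACA.
- by move=> X Y _ _; congr (_ + _); [apply: B1sym|apply: B2sym]; exact: memv_pi.
- move=> _ /memv_addP[X1 X1m [X2 X2m ->]] BX0.
  rewrite (B1nd X1) // => [|Y Ym]; last first.
    have := BX0 _ (subvP (addvSl _ _) _ Ym).
    rewrite -{1}[Y]addr0 orthogonal_sum_formE ?mem0v //.
    by rewrite (B2sym X2) ?mem0v // (inner_product0l B2P) // addr0.
  rewrite (B2nd X2) ?addr0 // => Y Ym.
  have := BX0 _ (subvP (addvSr _ _) _ Ym).
  rewrite -{1}[Y]add0r orthogonal_sum_formE ?mem0v //.
  by rewrite (B1sym X1) ?mem0v // (inner_product0l B1P) // add0r.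
Qed.

End OrthogonalSum.

(** The negative direction is put into [m2] when [B1] is Riemannian, and [m2] is
    made positive definite when [B1] is Lorentzian. *)
Lemma lorentzian_orthogonal_extension m1 m2 B1 : (m1 :&: m2 = 0)%VS -> m2 != 0%VS ->
  inner_product_on m1 B1 -> riemannian_on m1 B1 \/ lorentzian_on m1 B1 ->
  exists2 B2, inner_product_on m2 B2 &
    lorentzian_on (m1 + m2)%VS (orthogonal_sum_form m1 m2 B1 B2).
Proof.
move=> m12 m20 B1P B1type.
have m21 : (m2 :&: m1 = 0)%VS by rewrite capvC.
case: B1type => [B1pos|[p B1sig]].
- have dm2 : \dim m2 = ((\dim m2).-1 + 1)%N by rewrite addn1 prednK // lt0n dimv_eq0.
  have [B2 B2P B2sig] := inner_product_exists dm2.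
  exists B2 => //; exists (\dim m1 + (\dim m2).-1)%N.
  apply: has_signature_addv => //.
  + by move=> X Y Xm Ym; have [] := orthogonal_sum_form_orth m12 B1P B2P Xm Ym.
  + by move=> X Y Xm Ym; have [] := orthogonal_sum_form_orth m12 B1P B2P Xm Ym.
  + apply: eq_has_signature (riemannian_has_signature B1P B1pos) => X Y Xm Ym.
    by rewrite (orthogonal_sum_form_l B1 m12 B2P).
  + apply: eq_has_signature B2sig => X Y Xm Ym.
    by rewrite (orthogonal_sum_form_r B2 m12 B1P).
- have [B2 B2P B2sig] := inner_product_exists (esym (addn0 (\dim m2))).
  exists B2 => //; exists (\dim m2 + p)%N.
  (* In a basis adapted to the signature the negative vector comes last: [m2] goes
     first. *)
  rewrite addvC.
  apply: has_signature_addv => //.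
  + by move=> X Y Xm Ym; have [] := orthogonal_sum_form_orth m12 B1P B2P Ym Xm.
  + by move=> X Y Xm Ym; have [] := orthogonal_sum_form_orth m12 B1P B2P Ym Xm.
  + apply: eq_has_signature B2sig => X Y Xm Ym.
    by rewrite (orthogonal_sum_form_r B2 m12 B1P).
  + apply: eq_has_signature B1sig => X Y Xm Ym.
    by rewrite (orthogonal_sum_form_l B1 m12 B2P).
Qed.

End InnerProducts.

(** * The action of [l] on the complement [ms + zg] *)

Section CentralExtension.
Variables (R : realType) (n : nat).
Local Notation V := 'rV[R]_n.
Variables (br : V -> V -> V) (gs zg l ls ms : {vspace V}).
Hypotheses (brP : lie_bracket_axioms br).
Hypotheses (g_reductive : reductive_splitting br fullv gs zg).
Hypotheses (l_zg : (l :&: zg = 0)%VS) (ls_def : ls = (daddv_pi gs zg @: l)%VS).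
Implicit Types X Y Z : V.

(** The adjoint action depends only on the component in [gs] of the acting element,
    and ignores central summands. *)
Lemma bracket_mod_center X Y Z : Z \in zg -> br X (Y + Z) = br (daddv_pi gs zg X) Y.
Proof.
have [_ _ zgP gszg gs_zg] := g_reductive; have [brl brr _ _] := brP.
have br0 T U : T \in zg -> br T U = 0.
  by move=> /zgP[_]; apply; exact: memvf.
move=> Zz; rewrite addrC -[Z]scale1r brr scale1r.
rewrite (lie_bracketC _ _ brP) (br0 Z) // oppr0 add0r.
rewrite -{1}[X](daddv_pi_add gs_zg) ?gszg ?memvf // addrC.
by rewrite -[daddv_pi zg gs X]scale1r brl br0 ?memv_pi // scaler0 add0r.
Qed.

Hypothesis ms_reductive : reductive_complement br gs ls ms.

Lemma ms_sub_gs : (ms <= gs)%VS.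
Proof. by have [<- _ _] := ms_reductive; exact: addvSr. Qed.

Lemma ms_zg_disjoint : (ms :&: zg = 0)%VS.
Proof.
have [_ _ _ _ gs_zg] := g_reductive.
by apply/eqP; rewrite -subv0 -gs_zg capvS // ms_sub_gs.
Qed.

Lemma proj_l_mem X : X \in l -> daddv_pi gs zg X \in ls.
Proof. by rewrite ls_def; exact: memv_img. Qed.

Lemma reductive_complement_add_center :
  reductive_complement br fullv l (ms + zg)%VS.
Proof.
have [_ _ zgP gszg gs_zg] := g_reductive; have [lsms ls_ms br_ms] := ms_reductive.
split.
- apply/eqP; rewrite eqEsubv subvf -gszg subv_add -{1}lsms subv_add.
  have mz : (ms + zg <= l + (ms + zg))%VS by exact: addvSr.
  rewrite (subv_trans (addvSl ms zg) mz) (subv_trans (addvSr ms zg) mz) !andbT.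
  rewrite ls_def; apply/subvP => _ /memv_imgP[X Xl ->].
  (* The projection of [X] to [gs] is [X] minus its central component. *)
  rewrite -[daddv_pi gs zg X](addrK (daddv_pi zg gs X)).
  rewrite (daddv_pi_add gs_zg) ?gszg ?memvf //.
  by apply: memv_add => //; rewrite memvN (subvP (addvSr _ _)) // memv_pi.
- apply/eqP; rewrite -subv0; apply/subvP => X /memv_capP[Xl].
  move=> /memv_addP[Y Ym [Z Zz XYZ]].
  have piX : daddv_pi gs zg X = Y.
    by rewrite XYZ linearD /= (daddv_pi0 gs_zg Zz) addr0 daddv_pi_id // (subvP ms_sub_gs).
  have /eqP Y0 : Y == 0 by rewrite -memv0 -ls_ms memv_cap Ym andbT -piX proj_l_mem.
  have : X \in (l :&: zg)%VS by rewrite memv_cap Xl XYZ Y0 add0r.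
  by rewrite l_zg.
- move=> X _ Xl /memv_addP[Y Ym [Z Zz ->]].
  rewrite bracket_mod_center // (subvP (addvSl _ _)) // br_ms // proj_l_mem //.
Qed.

Lemma orthogonal_sum_invariant_metric gms h :
  invariant_metric br gs ls ms gms -> inner_product_on zg h ->
  invariant_metric br fullv l (ms + zg)%VS (orthogonal_sum_form ms zg gms h).
Proof.
move=> [_ gmsP gms_inv] hP; have [_ _ br_ms] := ms_reductive.
split; first exact: reductive_complement_add_center.
  exact: inner_product_orthogonal_sum ms_zg_disjoint gmsP hP.
move=> X _ _ Xl /memv_addP[Y1 Y1m [Y2 Y2z ->]] /memv_addP[Z1 Z1m [Z2 Z2z ->]].
have Xs := proj_l_mem Xl; have zg0 := mem0v zg; have [_ hsym _] := hP.
rewrite !bracket_mod_center // -[br _ Y1]addr0 -[br _ Z1]addr0.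
rewrite !(orthogonal_sum_formE _ _ ms_zg_disjoint) ?br_ms //.
by rewrite (hsym Y2) // !(inner_product0l hP) // !addr0 gms_inv.
Qed.

End CentralExtension.

Theorem theorem3p3
  (R : realType) (G : topologicalGroupType) (n : nat)
  (S : lie_group_structure R G n)
  (gs zg : {vspace 'rV[R]_n})
  (L : set G) (l ls ms : {vspace 'rV[R]_n})
  (G_connected : connected [set: G])
  (g_reductive : reductive_splitting (lie_br S) fullv gs zg)
  (G_product : forall x : G, exists a z : G,
     [/\ analytic_subgroup S gs a, group_center G z & x = (a * z)%g])
  (ZG_connected : connected (group_center G))
  (ZG_nontrivial : group_center G <> [set 1%g])
  (L_subgroup : subgroup L) (L_closed : closed L) (L_connected : connected L)
  (L_algebra : is_lie_algebra_of S L l)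
  (L_reductive : lie_reductive (lie_br S) l)
  (L_effective : almost_effective L)
  (ls_def : ls = (daddv_pi gs zg @: l)%VS)
  (Ls_closed : closed_in_analytic S gs (analytic_subgroup S ls))
  (ms_reductive : reductive_complement (lie_br S) gs ls ms)
  (gms : 'rV[R]_n -> 'rV[R]_n -> R)
  (gms_invariant : invariant_metric (lie_br S) gs ls ms gms)
  (gms_type : riemannian_on ms gms \/ lorentzian_on ms gms) :
  exists gm : 'rV[R]_n -> 'rV[R]_n -> R,
    [/\ invariant_metric (lie_br S) fullv l (ms + zg)%VS gm,
        lorentzian_on (ms + zg)%VS gm
      & forall X Y, X \in ms -> Y \in ms -> gm X Y = gms X Y].
Proof.
have [_ _ zgP _ _] := g_reductive.
have zg_neq0 := lie_center_neq0 zgP ZG_connected ZG_nontrivial.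
have l_zg := effective_center_trivial zgP G_product L_algebra L_effective.
have ms_zg := ms_zg_disjoint g_reductive ms_reductive.
have [_ gmsP _] := gms_invariant.
have [h hP gm_lorentz] := lorentzian_orthogonal_extension ms_zg zg_neq0 gmsP gms_type.
exists (orthogonal_sum_form ms zg gms h); split=> //.
- exact: (orthogonal_sum_invariant_metric (lie_brP S) g_reductive l_zg ls_def ms_reductive).
- exact: orthogonal_sum_form_l.
Qed.
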